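(* Let $\epsilon\in(0,1/2)$ and let $\epsilon_1,\dots,\epsilon_d>0$ satisfy $\sum_{t=1}^d\epsilon_t=\epsilon$. Consider the sequential affine detection procedure described in the context, and let the observation noise $\xi^d$ have any zero mean sub-Gaussian distribution with sub-Gaussianity matrix $\Theta\in\mathcal U$. Then: (i) when the input $x$ is a feasible nuisance (i.e. $x\in N$), the probability that the procedure terminates with the signal conclusion at time $t\in\{1,\dots,d\}$ does not exceed $\epsilon_t$, and thus the probability of a false alarm (signal conclusion at some time $t\in\{1,\dots,d\}$) is at most $\epsilon=\sum_{t=1}^d\epsilon_t$; (ii) when $t\in\{1,\dots,d\}$ and $k\in\{1,\dots,K\}$ are such that $\rho_{tk}<\infty$, and the input $x$ belongs to a set $X_k^\rho$ with $\rho\ge\rho_{tk}$, the probability that the procedure terminates with the signal conclusion at step $t$ or earlier is at least $1-\epsilon$.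
   Context: **Notation.** $\mathbf S^m$ is the space of real symmetric $m\times m$ matrices, $\mathbf S^m_+$ the cone of positive semidefinite ones, $A\succeq B$ means $A-B\in\mathbf S^m_+$. A Borel probability distribution $P$ on $\mathbf R^m$ is sub-Gaussian with parameters $(u,\Theta)$, $u\in\mathbf R^m$, $\Theta\in\mathbf S^m_+$ ($\Theta$ is the sub-Gaussianity matrix), if $\ln\int e^{h^Ty}P(dy)\le u^Th+\frac12h^T\Theta h$ for all $h\in\mathbf R^m$; then $u$ is the mean of $P$. **Observations.** An unknown deterministic input $x\in\mathbf R^n$ is observed through $y^t=\bar A_tx+\xi^t=S_t[\bar A_dx+\xi^d]\in\mathbf R^{\nu_t}$, $t=1,\dots,d$, where $1\le\nu_1\le\dots\le\nu_d$, $\bar A_d$ is a given $\nu_d\times n$ matrix, $S_t$ is a given $\nu_t\times\nu_d$ matrix of rank $\nu_t$ ($S_d=I$), $S_{t-1}=R_tS_t$ for some matrix $R_t$, $\bar A_t=S_t\bar A_d$, $\xi^t=S_t\xi^d$, and $\xi^d$ is random noise. $\mathcal U$ is a given nonempty convex compact subset of $\mathrm{int}\,\mathbf S^{\nu_d}_+$, and $\mathcal U_t=\{S_t\Theta S_t^T:\Theta\in\mathcal U\}$. **Inputs.** $X\subset\mathbf R^n$ is a convex compact set; the set of feasible nuisances $N\subset X$ is closed and convex with $0\in N$. For $k=1,\dots,K$: $W_k\subset\mathbf R^n$ is a nonempty closed convex set with $0\notin W_k$ and $\rho w\in W_k$ whenever $w\in W_k$, $\rho\ge1$; $V_k\subset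 X$ is a nonempty compact convex set with $0\in V_k$. For $\rho>0$, $W_k^\rho=\{\rho y:y\in W_k\}$ and $X_k^\rho=[V_k+W_k^\rho]\cap X$ (feasible signals of shape $k$ and magnitude $\ge\rho$). It is assumed that for every $k$ the set $X_k^\rho$ is nonempty for some $\rho>0$; $R_k>0$ denotes the largest $\rho$ for which $X_k^\rho\neq\emptyset$. **Saddle point values.** Let $N^t=\bar A_tN$, $U^t_{k\rho}=\{\bar A_tx:x\in X_k^\rho\}$, and for $\rho\in(0,R_k]$ $$\mathcal{SV}_{tk}(\rho)=\min_{h\in\mathbf R^{\nu_t}}\ \max_{\theta_1\in N^t,\ \theta_2\in U^t_{k\rho},\ \Theta\in\mathcal U_t}\left[\tfrac12h^T[\theta_2-\theta_1]+\tfrac12h^T\Theta h\right].$$ A saddle point $(h_{tk\rho};\theta^1_{tk\rho},\theta^2_{tk\rho},\Theta_{tk\rho})$ exists; the associated affine detector is $\phi_{tk\rho}(y^t)=h_{tk\rho}^T\left[y^t-\tfrac12(\theta^1_{tk\rho}+\theta^2_{tk\rho})\right]$. **Procedure.** For $\varkappa\in(0,1]$ let $\mathcal K_t(\varkappa)=\{k\le K:\mathcal{SV}_{tk}(R_k)<\ln\varkappa\}$, $K_t(\varkappa)=\mathrm{Card}\,\mathcal K_t(\varkappa)$, and $\varkappa_t=\sup\{\varkappa\in(0,1]:K_t(\varkappa)\le\epsilon\epsilon_t/\varkappa^2\}$. For $k\in\mathcal K_t(\varkappa_t)$ let $\rho_{tk}\in(0,R_k)$ be such that $\mathcal{SV}_{tk}(\rho_{tk})=\ln\varkappa_t$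 (such $\rho_{tk}$ exists) and set $\phi_{tk}=\phi_{tk\rho_{tk}}$; for $k\notin\mathcal K_t(\varkappa_t)$ set $\rho_{tk}=+\infty$. Let $\alpha_t=\ln(\varkappa_t/\epsilon)$. At step $t$, given $y^t$: if there is $k$ with $\rho_{tk}<\infty$ and $\phi_{tk}(y^t)<\alpha_t$, the procedure claims that the input is a signal and terminates (signal conclusion at time $t$); otherwise it passes to time $t+1$ (if $t<d$) or terminates without a signal conclusion (if $t=d$). *)

(* Defs.v *)
From HB Require Import structures.
From mathcomp Require Import all_boot all_order all_algebra.
From mathcomp Require Import all_classical all_reals all_analysis.

Set Implicit Arguments.
Unset Strict Implicit.
Unset Printing Implicit Defensive.

Import Order.TTheory GRing.Theory Num.Theory.
Import numFieldNormedType.Exports.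

Local Open Scope classical_set_scope.
Local Open Scope ring_scope.

Section linear_algebra.
Context {R : realType} {m : nat}.

Definition dotv (u v : 'cV[R]_m) : R := (u^T *m v) 0 0.

Definition quadf (A : 'M[R]_m) (h : 'cV[R]_m) : R := (h^T *m A *m h) 0 0.

Definition sym_mx : set 'M[R]_m := [set A | A^T = A].

Definition psd_mx : set 'M[R]_m :=
  [set A | sym_mx A /\ forall h, 0 <= quadf A h].

(* The interior is taken in the space of symmetric matrices: psd_mx has empty
   interior in 'M[R]_m as soon as 1 < m. *)
Definition psd_interior : set 'M[R]_m :=
  [set A | sym_mx A /\ \forall B \near within sym_mx (nbhs A), psd_mx B].

End linear_algebra.

(* R^m with its Borel sigma-algebra. *)
Definition borel_cV (R : realType) (m : nat) :=
  g_sigma_algebraType (@open 'cV[R]_m).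

Definition sub_gaussian (R : realType) (m : nat)
    (Q : probability (borel_cV R m) R) (u : 'cV[R]_m) (Theta : 'M[R]_m) : Prop :=
  psd_mx Theta /\
  forall h : 'cV[R]_m,
    (lne (\int[Q]_y (expR (dotv h y))%:E) <=
       (dotv u h + 2^-1 * quadf Theta h)%:E)%E.

Section saddle_point.
Context {R : realType} {m : nat}.
Variables (T1 T2 : set 'cV[R]_m) (Q : set 'M[R]_m).

Definition sp_objective (h th1 th2 : 'cV[R]_m) (Theta : 'M[R]_m) : R :=
  2^-1 * dotv h (th2 - th1) + 2^-1 * quadf Theta h.

(* The min-max value, in the extended reals so that inf and sup are total. *)
Definition sp_value : \bar R :=
  ereal_inf (range (fun h : 'cV[R]_m =>
    ereal_sup [set r : \bar R | exists th1 th2 Theta,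
      [/\ T1 th1, T2 th2, Q Theta & r = (sp_objective h th1 th2 Theta)%:E]])).

Definition is_saddle_point (h th1 th2 : 'cV[R]_m) (Theta : 'M[R]_m) : Prop :=
  [/\ T1 th1, T2 th2, Q Theta,
      forall h', sp_objective h th1 th2 Theta <= sp_objective h' th1 th2 Theta &
      forall th1' th2' Theta', T1 th1' -> T2 th2' -> Q Theta' ->
        sp_objective h th1' th2' Theta' <= sp_objective h th1 th2 Theta].

End saddle_point.

(* Times are the naturals t with 1 <= t <= nsteps; nu and Smx are only
   meaningful there. *)
Record problem (R : realType) := Problem {
  sdim : nat;
  nsteps : nat;
  nshapes : nat;
  nu : nat -> nat;
  Amx : 'M[R]_(nu nsteps, sdim);
  Smx : forall t : nat, 'M[R]_(nu t, nu nsteps);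
  Uset : set 'M[R]_(nu nsteps);
  Xset : set 'cV[R]_sdim;
  Nset : set 'cV[R]_sdim;
  Vset : 'I_nshapes -> set 'cV[R]_sdim;
  Wset : 'I_nshapes -> set 'cV[R]_sdim }.

Arguments Uset {R} p _.
Arguments Xset {R} p _.
Arguments Nset {R} p _.
Arguments Vset {R p} k _.
Arguments Wset {R p} k _.

Section signals.
Context {R : realType} (p : problem R).

Definition Wscaled (k : 'I_(nshapes p)) (rho : R) : set 'cV[R]_(sdim p) :=
  [set rho *: y | y in Wset k].

(* X_k^rho = [V_k + W_k^rho] cap X. *)
Definition signals (k : 'I_(nshapes p)) (rho : R) : set 'cV[R]_(sdim p) :=
  [set v + w | v in Vset k & w in Wscaled k rho] `&` Xset p.

Definition is_max_magnitude (k : 'I_(nshapes p)) (r : R) : Prop :=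
  [/\ 0 < r, signals k r !=set0 &
      forall rho, 0 < rho -> signals k rho !=set0 -> rho <= r].

Record standing_assumptions : Prop := StandingAssumptions {
  nsteps_gt0 : (1 <= nsteps p)%N;
  nu_gt0 : forall t, (1 <= t <= nsteps p)%N -> (1 <= nu p t)%N;
  nu_homo : forall s t, (1 <= s <= t)%N -> (t <= nsteps p)%N ->
    (nu p s <= nu p t)%N;
  rank_Smx : forall t, (1 <= t <= nsteps p)%N -> \rank (Smx p t) = nu p t;
  Smx_last : Smx p (nsteps p) = 1%:M;
  Smx_pred : forall t, (2 <= t <= nsteps p)%N ->
    exists Rt : 'M[R]_(nu p t.-1, nu p t), Smx p t.-1 = Rt *m Smx p t;
  Uset_ok : [/\ Uset p !=set0, convex_set (Uset p), compact (Uset p) &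
    Uset p `<=` psd_interior];
  Xset_ok : convex_set (Xset p) /\ compact (Xset p);
  Nset_ok : [/\ Nset p `<=` Xset p, closed (Nset p), convex_set (Nset p) &
    Nset p 0];
  Wset_ok : forall k : 'I_(nshapes p),
    [/\ Wset k !=set0, closed (Wset k), convex_set (Wset k), ~ Wset k 0 &
      forall (rho : R) w, Wset k w -> 1 <= rho -> Wset k (rho *: w)];
  Vset_ok : forall k : 'I_(nshapes p),
    [/\ Vset k `<=` Xset p, Vset k !=set0, compact (Vset k),
      convex_set (Vset k) & Vset k 0];
  signals_ok : forall k : 'I_(nshapes p),
    exists2 rho : R, 0 < rho & signals k rho !=set0 }.

Definition Abar (t : nat) : 'M[R]_(nu p t, sdim p) := Smx p t *m Amx p.

Definition obs (x : 'cV[R]_(sdim p)) (xi : 'cV[R]_(nu p (nsteps p))) (t : nat)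
  : 'cV[R]_(nu p t) := Smx p t *m (Amx p *m x + xi).

Definition Nobs (t : nat) : set 'cV[R]_(nu p t) :=
  [set Abar t *m x | x in Nset p].

Definition Uobs (t : nat) (k : 'I_(nshapes p)) (rho : R) : set 'cV[R]_(nu p t) :=
  [set Abar t *m x | x in signals k rho].

Definition Ut (t : nat) : set 'M[R]_(nu p t) :=
  [set Smx p t *m Theta *m (Smx p t)^T | Theta in Uset p].

End signals.

Arguments Wscaled {R p} k rho _.
Arguments signals {R p} k rho _.
Arguments is_max_magnitude {R p} k r.
Arguments Abar {R} p t.
Arguments obs {R p} x xi t.
Arguments Nobs {R} p t _.
Arguments Uobs {R p} t k rho _.
Arguments Ut {R} p t _.

Definition SV (R : realType) (p : problem R) (t : nat) (k : 'I_(nshapes p)) (rho : R) : \bar R :=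
  sp_value (Nobs p t) (Uobs t k rho) (Ut p t).

Section procedure.
Context {R : realType} (p : problem R).
Variables (Rmax : 'I_(nshapes p) -> R) (eps : R) (epst : nat -> R).

Definition Kset (t : nat) (kappa : R) : pred 'I_(nshapes p) :=
  [pred k | (SV t k (Rmax k) < (ln kappa)%:E)%E].

Definition kappat (t : nat) : R :=
  sup [set kappa : R | 0 < kappa <= 1 /\
                       #|Kset t kappa|%:R <= eps * epst t / kappa ^+ 2].

Definition alphat (t : nat) : R := ln (kappat t / eps).

(* rhot t k is the threshold magnitude; ht, th1t, th2t, Thetat are the
   components of the saddle point at that magnitude, irrelevant when
   rhot t k = +oo. *)
Record tests := Tests {
  rhot : nat -> 'I_(nshapes p) -> \bar R;
  ht : forall t, 'I_(nshapes p) -> 'cV[R]_(nu p t);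
  th1t : forall t, 'I_(nshapes p) -> 'cV[R]_(nu p t);
  th2t : forall t, 'I_(nshapes p) -> 'cV[R]_(nu p t);
  Thetat : forall t, 'I_(nshapes p) -> 'M[R]_(nu p t) }.

Definition valid_tests (T : tests) : Prop :=
  forall (t : nat) (k : 'I_(nshapes p)), (1 <= t <= nsteps p)%N ->
    (k \in Kset t (kappat t) ->
       exists r : R,
         [/\ rhot T t k = r%:E, 0 < r < Rmax k,
             SV t k r = (ln (kappat t))%:E &
             is_saddle_point (Nobs p t) (Uobs t k r) (Ut p t)
               (ht T t k) (th1t T t k) (th2t T t k) (Thetat T t k)]) /\
    (k \notin Kset t (kappat t) -> rhot T t k = +oo%E).

Definition detector (T : tests) (t : nat) (k : 'I_(nshapes p))
    (y : 'cV[R]_(nu p t)) : R := dotv (ht T t k) (y - 2^-1 *: (th1t T t k + th2t T t k)).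

Definition claims (T : tests) (t : nat) (y : 'cV[R]_(nu p t)) : Prop :=
  exists k, (rhot T t k < +oo)%E /\ detector T k y < alphat t.

Definition signal_at (T : tests) (y : forall t, 'cV[R]_(nu p t)) (t : nat)
  : Prop :=
  claims T (y t) /\ forall s, (1 <= s < t)%N -> ~ claims T (y s).

End procedure.

(* Main.v *)
Require Import Defs.
From HB Require Import structures.
From mathcomp Require Import all_boot all_order all_algebra.
From mathcomp Require Import all_classical all_reals all_analysis.
From mathcomp Require Import measurable_realfun lra.

Set Implicit Arguments.
Unset Strict Implicit.
Unset Printing Implicit Defensive.

Import Order.TTheory GRing.Theory Num.Theory.
Import numFieldNormedType.Exports.

Local Open Scope classical_set_scope.
Local Open Scope ring_scope.

(** The objective of the saddle point problem is separable in its maximization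
    variables, so at the saddle point each of the three terms dominates its
    value at the true signal and noise parameters.  With [phi] the detector at
    the saddle point of value [ln kappa], the sub-Gaussian bound then gives
    [E exp(-phi) <= kappa] under a nuisance and [E exp(phi) <= kappa] under a
    signal of magnitude at least [rho_tk], whence, by Chernoff's bound,
    [P(phi < alpha) <= kappa^2/eps] and [P(phi >= alpha) <= eps] respectively.
    The union bound over the active shapes closes the first estimate because
    the supremum defining [kappa_t] is attained:
    [K_t(kappa_t) <= eps eps_t / kappa_t^2]. *)

(** * Algebra of the pairing and of quadratic forms *)

Section bilinear.
Context {R : realType}.

Lemma dotvDr m (h u v : 'cV[R]_m) : dotv h (u + v) = dotv h u + dotv h v.
Proof. by rewrite /dotv mulmxDr mxE. Qed.

Lemma dotvZr m (h : 'cV[R]_m) a v : dotv h (a *: v) = a * dotv h v.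
Proof. by rewrite /dotv -scalemxAr mxE. Qed.

Lemma dotvNr m (h v : 'cV[R]_m) : dotv h (- v) = - dotv h v.
Proof. by rewrite /dotv mulmxN mxE. Qed.

Lemma dotvNl m (h v : 'cV[R]_m) : dotv (- h) v = - dotv h v.
Proof. by rewrite /dotv [(- h)^T]linearN /= mulNmx mxE. Qed.

Lemma dotv0l m (v : 'cV[R]_m) : dotv 0 v = 0.
Proof. by rewrite /dotv trmx0 mul0mx mxE. Qed.

Lemma dotv_mulmxr m n (S : 'M[R]_(m, n)) h v :
  dotv h (S *m v) = dotv (S^T *m h) v.
Proof. by rewrite /dotv trmx_mul trmxK mulmxA. Qed.

Lemma quadfN m (A : 'M[R]_m) h : quadf A (- h) = quadf A h.
Proof. by rewrite /quadf [(- h)^T]linearN /= mulmxN !mulNmx opprK. Qed.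

Lemma quadf_congr m n (S : 'M[R]_(m, n)) A h :
  quadf (S *m A *m S^T) h = quadf A (S^T *m h).
Proof. by rewrite /quadf trmx_mul trmxK !mulmxA. Qed.

End bilinear.

(** * Consequences of the saddle point property *)

Section saddle_point_theory.
Context {R : realType} {m : nat}.
Variables (T1 T2 : set 'cV[R]_m) (Q : set 'M[R]_m).
Variables (h th1 th2 : 'cV[R]_m) (Theta : 'M[R]_m).
Hypothesis sp : is_saddle_point T1 T2 Q h th1 th2 Theta.

(** Playing [h] bounds the infimum from above, by maximality of the triple; for any [h'], keeping
    [th1], [th2], [Theta] bounds the inner supremum from below, by minimality of [h]. *)
Lemma sp_value_saddle :
  sp_value T1 T2 Q = (sp_objective h th1 th2 Theta)%:E.
Proof.
case: sp => T1t T2t Qt minh maxt; apply/eqP; rewrite eq_le; apply/andP; split.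
  apply: (@le_trans _ _ (ereal_sup [set r : \bar R | exists u1 u2 Th,
      [/\ T1 u1, T2 u2, Q Th & r = (sp_objective h u1 u2 Th)%:E]])).
    by apply: ereal_inf_lbound; exists h.
  apply: ge_ereal_sup => _ [u1 [u2 [Th [? ? ? ->]]]].
  by rewrite lee_fin maxt.
apply: le_ereal_inf_tmp => _ [h' _ <-].
apply: (@le_trans _ _ (sp_objective h' th1 th2 Theta)%:E).
  by rewrite lee_fin minh.
by apply: ereal_sup_ubound; exists th1, th2, Theta.
Qed.

(* The objective is separable in [th1], [th2] and [Theta], so maximality of the
   triple is maximality of each component. *)
Lemma saddle_le1 u Th : T1 u -> Q Th ->
  2^-1 * dotv h (th1 + th2) - dotv h u + 2^-1 * quadf Th h <=
  sp_objective h th1 th2 Theta.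
Proof.
case: sp => T1t T2t Qt _ maxt T1u QTh.
(* Deviations in [th1] alone and in [Theta] alone; the first, halved in the objective, is used
   twice. *)
have := maxt _ _ _ T1u T2t Qt; have := maxt _ _ _ T1t T2t QTh.
rewrite /sp_objective !dotvDr !dotvNr; lra.
Qed.

(** The left side is the sub-Gaussian bound on [ln E exp(phi)] for an observation of mean [u] and
    matrix [Th]; in [saddle_le1] it is the one for [-phi]. *)
Lemma saddle_le2 u Th : T2 u -> Q Th ->
  dotv h u - 2^-1 * dotv h (th1 + th2) + 2^-1 * quadf Th h <=
  sp_objective h th1 th2 Theta.
Proof.
case: sp => T1t T2t Qt _ maxt T2u QTh.
have := maxt _ _ _ T1t T2u Qt; have := maxt _ _ _ T1t T2t QTh.
rewrite /sp_objective !dotvDr !dotvNr; lra.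
Qed.

End saddle_point_theory.

(** * Finite unions, applied to shapes and to times *)

Section finite_unions.
Context {R : realType} d (T : measurableType d).

Lemma measurable_exists2_seq (I : eqType) (r : seq I) (A : I -> set T) :
  (forall i, i \in r -> measurable (A i)) ->
  measurable [set w | exists2 i, i \in r & A i w].
Proof.
elim: r => [|i r IH] mA.
  by rewrite (_ : mkset _ = set0) -?subset0// => w [].
rewrite (_ : mkset _ = A i `|` [set w | exists2 j, j \in r & A j w]).
  apply: measurableU; first by apply: mA; rewrite mem_head.
  by apply: IH => j jr; apply: mA; rewrite in_cons jr orbT.
apply/seteqP; split=> w /=.
  by case=> j; rewrite in_cons => /predU1P[->|jr] ?; [left|right; exists j].
case=> [?|[j jr ?]]; first by exists i; rewrite ?mem_head.
by exists j; rewrite // in_cons jr orbT.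
Qed.

Lemma measure_exists2_seq_le (mu : {measure set T -> \bar R}) (I : eqType)
    (r : seq I) (A : I -> set T) (c : I -> R) :
  (forall i, i \in r -> measurable (A i)) ->
  (forall i, i \in r -> (mu (A i) <= (c i)%:E)%E) ->
  (mu [set w | exists2 i, i \in r & A i w] <= (\sum_(i <- r) c i)%:E)%E.
Proof.
elim: r => [|i r IH] mA lec.
  rewrite big_nil (_ : mkset _ = set0) ?measure0//.
  by rewrite -subset0 => w [].
have mA' j : j \in r -> measurable (A j).
  by move=> jr; apply: mA; rewrite in_cons jr orbT.
rewrite (_ : mkset _ = A i `|` [set w | exists2 j, j \in r & A j w]).
  rewrite big_cons EFinD.
  have mAi : measurable (A i) by apply: mA; rewrite mem_head.
  apply: le_trans (measureU2 mu mAi (measurable_exists2_seq mA')) _.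
  apply: leeD; first by apply: lec; rewrite mem_head.
  by apply: IH => // j jr; apply: lec; rewrite in_cons jr orbT.
apply/seteqP; split=> w /=.
  by case=> j; rewrite in_cons => /predU1P[->|jr] ?; [left|right; exists j].
case=> [?|[j jr ?]]; first by exists i; rewrite ?mem_head.
by exists j; rewrite // in_cons jr orbT.
Qed.

End finite_unions.

(** * Linear forms of sub-Gaussian noise *)

Section sub_gaussian_theory.
Context {R : realType} {m : nat}.

Lemma measurable_dotv (h : 'cV[R]_m) :
  measurable_fun setT (fun y : borel_cV R m => dotv h y).
Proof.
rewrite (_ : (fun y => _) = fun y : borel_cV R m =>
    \sum_j h j 0 * (y : 'cV[R]_m) j 0); last first.
  by apply/funext => y; rewrite /dotv mxE; apply: eq_bigr => j _; rewrite mxE.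
apply: measurable_sum => j; apply: measurable_funM; first exact: measurable_cst.
(* Open half-lines generate the Borel sets of the line, and a coordinate, being continuous, pulls
   them back to open sets. *)
apply: (measurability _ (RGenOInfty.measurableE R)) => _ [_ [x ->] <-].
rewrite setTI; apply: sub_sigma_algebra.
apply: (@open_comp 'cV[R]_m R (fun M => M j 0) `]x, +oo[%classic).
  by move=> M _; exact: coord_continuous.
exact: interval_open.
Qed.

Context d (Omega : measurableType d) (P : probability Omega R).
Variables (xi : {mfun Omega >-> borel_cV R m}) (Theta : 'M[R]_m).

Lemma measurable_dotv_comp (h : 'cV[R]_m) :
  measurable_fun setT (fun w => dotv h (xi w)).
Proof. exact: (measurableT_comp (measurable_dotv h)). Qed.

(** Chernoff's bound with parameter 1, the scale being carried by [h]. Exponentiating in the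
    extended reals undoes [lne] without knowing beforehand that the moment is finite. *)
Lemma sub_gaussian_tail (h : 'cV[R]_m) (a : R) :
  sub_gaussian (distribution P xi) 0 Theta ->
  (P [set w | (a <= dotv h (xi w))%R] <= (expR (2^-1 * quadf Theta h - a))%:E)%E.
Proof.
move=> [_ /(_ h)]; rewrite dotv0l add0r => mgf.
pose X : {mfun Omega >-> R} :=
  HB.pack_for {mfun Omega >-> R} (fun w => dotv h (xi w))
    (isMeasurableFun.Build _ _ _ _ _ (measurable_dotv_comp h)).
have := chernoff (X : {RV P >-> R}) a ltr01; rewrite mul1r => /le_trans; apply.
rewrite expRD EFinM; apply: lee_wpmul2r; first by rewrite lee_fin expR_ge0.
move: mgf; rewrite -lee_expeR lneK; last first.
  rewrite in_itv/= leey andbT; apply: integral_ge0 => y _.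
  by rewrite lee_fin expR_ge0.
apply: le_trans; rewrite ge0_integral_distribution//; last first.
  apply/measurable_EFinP; apply: measurableT_comp (measurable_dotv h).
  exact: measurable_expR.
rewrite /mmt_gen_fun unlock/=.
by under eq_integral do rewrite /= mulr1.
Qed.

End sub_gaussian_theory.

(** * The level [kappat] and its admissibility *)

Section levels.
Context {R : realType} (p : problem R).
Variables (Rmax : 'I_(nshapes p) -> R) (eps : R) (epst : nat -> R) (t : nat).
Hypotheses (eps_gt0 : 0 < eps) (epst_gt0 : 0 < epst t).

Let admissible := [set kappa : R | 0 < kappa <= 1 /\
  #|Kset Rmax t kappa|%:R <= eps * epst t / kappa ^+ 2].

Lemma Kset_homo (a b : R) : 0 < a -> a <= b ->
  {subset Kset Rmax t a <= Kset Rmax t b}.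
Proof.
move=> a0 ab k; rewrite !inE => /lt_le_trans; apply.
by rewrite lee_fin ler_ln// posrE (lt_le_trans a0).
Qed.

Let admissible_sup : has_sup admissible.
Proof.
split; last by exists 1 => x [/andP[]].
pose c := eps * epst t; have c0 : 0 < c by rewrite mulr_gt0.
(* [K] bounds every cardinality, and the successor keeps it positive when there are no shapes;
   [x <= 1] will give [x ^+ 2 <= x]. *)
pose K : R := (nshapes p).+1%:R; have K0 : 0 < K by rewrite ltr0n.
pose x := Num.min 1 (c / K).
have x0 : 0 < x by rewrite lt_min ltr01 divr_gt0.
have x1 : x <= 1 by rewrite ge_min lexx.
have xc : x * K <= c by rewrite -ler_pdivlMr// ge_min lexx orbT.
exists x; split; first by rewrite x0.
rewrite ler_pdivlMr ?exprn_gt0//; apply: le_trans xc.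
rewrite mulrC; apply: ler_pM => //; first by rewrite exprn_ge0// ltW.
  by rewrite expr2 ler_piMl// ltW.
by rewrite ler_nat (leq_trans (max_card _))// card_ord.
Qed.

Lemma kappat_gt0 : 0 < kappat Rmax eps epst t.
Proof.
have [[x xA] ub] := admissible_sup.
by apply: lt_le_trans (ub_le_sup ub xA); case: xA => /andP[].
Qed.

(* [Kset] is left continuous in [kappa], hence the supremum is attained. *)
Lemma card_Kset_kappat : #|Kset Rmax t (kappat Rmax eps epst t)|%:R <=
  eps * epst t / kappat Rmax eps epst t ^+ 2.
Proof.
set b := kappat Rmax eps epst t; have b0 : 0 < b := kappat_gt0.
rewrite ler_pdivlMr ?exprn_gt0// leNgt; apply/negP => lt_c.
(* Membership is a strict inequality between the saddle value and [ln b], so it survives a small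
   decrease of [b]; the value [-oo] survives any. *)
have left_cont k :
    \forall a \near b^'-, k \in Kset Rmax t b -> k \in Kset Rmax t a.
  have [|] := boolP (k \in Kset Rmax t b); last by move=> _; near=> a.
  rewrite inE; case SVk : (SV _ _ _) => [r| |]// h; last first.
    by near=> a => _; rewrite inE SVk ltNyr.
  have rb : expR r < b by rewrite -ltr_ln ?posrE ?expR_gt0// expRK -lte_fin.
  near=> a => _.
  have ra : expR r < a by near: a; exact: nbhs_left_gt.
  have a0 : 0 < a := lt_trans (expR_gt0 r) ra.
  by rewrite inE SVk lte_fin -(expRK r) ltr_ln// posrE expR_gt0.
near b^'- => a.
have a0 : 0 < a by near: a; exact: nbhs_left_gt.
have ab : a < b by near: a; exact: nbhs_left_lt.
(* There are finitely many shapes, so one [a] serves them all. *)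
have Kba : {subset Kset Rmax t b <= Kset Rmax t a}.
  by near: a; exact: filter_forall.
have ca : eps * epst t < #|Kset Rmax t b|%:R * a ^+ 2.
  near: a; apply: cvgr_gt lt_c; apply: cvgMr.
  by apply: cvg_at_left_filter; exact: exprn_continuous.
(* By monotonicity [Kset] at [x] contains [Kset] at [b], so admissibility of some [x > a]
   contradicts [ca]. *)
have [x [/andP[x0 _] xA] ax] : exists2 x, admissible x & a < x.
  by apply: sup_gt => //; case: admissible_sup.
have : #|Kset Rmax t b|%:R <= eps * epst t / x ^+ 2.
  apply: le_trans xA; rewrite ler_nat.
  apply/subset_leq_card/fintype.subsetP => k /Kba.
  exact: Kset_homo (ltW ax) _.
rewrite ler_pdivlMr ?exprn_gt0// leNgt => /negP; apply.
apply: lt_le_trans ca _; apply: ler_wpM2l => //.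
by rewrite lerXn2r ?nnegrE ?ltW.
Unshelve. all: end_near. Qed.

End levels.

(** The factor [rho / r >= 1] is absorbed by the ray property of [Wset k]. This brings every
    stronger signal into the set for which the threshold saddle point was computed. *)
Lemma signals_nincr (R : realType) (p : problem R) (hp : standing_assumptions p)
    (k : 'I_(nshapes p)) (r rho : R) : 0 < r -> r <= rho ->
  signals k rho `<=` signals k r.
Proof.
move=> r0 rrho _ [[v Vv [_ [w Ww <-] <-]] Xx]; split=> //.
exists v => //; exists (rho *: w) => //.
exists ((rho / r) *: w); last by rewrite scalerA mulrC divfK// gt_eqF.
have [_ _ _ _ ray] := Wset_ok hp k.
by apply: ray => //; rewrite ler_pdivlMr// mul1r.
Qed.

(** * Events of the procedure and errors of a single detector *)

Section detection.
Context {R : realType} {p : problem R}.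
Variables (Rmax : 'I_(nshapes p) -> R) (eps : R) (epst : nat -> R).
Variables (T : tests p).
Context d (Omega : measurableType d) (P : probability Omega R).
Variables (xi : {mfun Omega >-> borel_cV R (nu p (nsteps p))}).

(** Moving [Smx p t] onto [ht] leaves a linear form in the last-step noise [z], so one sub-Gaussian
    hypothesis serves all times. *)
Lemma detector_obs x z t k : detector T k (obs x z t) =
  dotv ((Smx p t)^T *m ht T t k) z + dotv (ht T t k) (Abar p t *m x)
  - 2^-1 * dotv (ht T t k) (th1t T t k + th2t T t k).
Proof.
rewrite /detector /obs /Abar mulmxDr mulmxA !(dotvDr, dotvNr, dotvZr).
by rewrite (dotv_mulmxr _ _ z) [X in X - _]addrC.
Qed.

Lemma measurable_detector x t k :
  measurable_fun setT (fun w => detector T k (obs x (xi w) t)).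
Proof.
under eq_fun do rewrite detector_obs -addrA.
apply: measurable_funD; first exact: measurable_dotv_comp.
exact: measurable_cst.
Qed.

Lemma measurable_alarm x t k :
  measurable [set w | detector T k (obs x (xi w) t) < alphat Rmax eps epst t].
Proof.
rewrite -[mkset _]setTI; apply: measurable_fun_ltr => //.
exact: measurable_detector.
Qed.

Let active t := enum [pred k | (rhot T t k < +oo)%E].

Lemma claimsE x t : [set w | claims Rmax eps epst T (obs x (xi w) t)] =
  [set w | exists2 k, k \in active t &
     detector T k (obs x (xi w) t) < alphat Rmax eps epst t].
Proof.
apply/seteqP; split=> w /=.
  by case=> k [kT dk]; exists k; rewrite // mem_enum inE.
by case=> k; rewrite mem_enum inE => kT dk; exists k.
Qed.

Lemma measurable_claims x t :
  measurable [set w | claims Rmax eps epst T (obs x (xi w) t)].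
Proof.
by rewrite claimsE; apply: measurable_exists2_seq => k _; exact: measurable_alarm.
Qed.

Lemma measurable_signal_at x t :
  measurable [set w | signal_at Rmax eps epst T (obs x (xi w)) t].
Proof.
rewrite (_ : mkset _ = [set w | claims Rmax eps epst T (obs x (xi w) t)] `\`
    [set w | exists2 s, s \in index_iota 1 t &
               claims Rmax eps epst T (obs x (xi w) s)]).
  apply: measurableD; first exact: measurable_claims.
  by apply: measurable_exists2_seq => s _; exact: measurable_claims.
apply/seteqP; split=> w /= [ct nc]; split=> //.
  by move=> [s]; rewrite mem_index_iota => /nc.
by move=> s st cs; apply: nc; exists s; rewrite // mem_index_iota.
Qed.

Lemma signal_beforeE x t :
  [set w | exists2 s, (1 <= s <= t)%N &
             signal_at Rmax eps epst T (obs x (xi w)) s] =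
  [set w | exists2 s, s \in index_iota 1 t.+1 &
             signal_at Rmax eps epst T (obs x (xi w)) s].
Proof.
by apply/seteqP; split=> w [s hs sg]; exists s => //; move: hs;
  rewrite mem_index_iota ltnS.
Qed.

Lemma measurable_signal_before x t :
  measurable [set w | exists2 s, (1 <= s <= t)%N &
                        signal_at Rmax eps epst T (obs x (xi w)) s].
Proof.
rewrite signal_beforeE.
by apply: measurable_exists2_seq => s _; exact: measurable_signal_at.
Qed.

(** The procedure stops at the least positive time at which a claim occurs. *)
Lemma claims_signal_before (y : forall t, 'cV[R]_(nu p t)) t : (1 <= t)%N ->
  claims Rmax eps epst T (y t) ->
  exists2 s, (1 <= s <= t)%N & signal_at Rmax eps epst T y s.
Proof.
move=> t1 ct.
have ex : exists s, (1 <= s)%N && `[< claims Rmax eps epst T (y s) >].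
  by exists t; rewrite t1; exact/asboolP.
case: (ex_minnP ex) => s /andP[s1 /asboolP cs] smin.
exists s; first by rewrite s1 smin// t1; exact/asboolP.
split=> // u /andP[u1 us] cu; move: us; rewrite ltnNge => /negP; apply.
by apply: smin; rewrite u1; exact/asboolP.
Qed.

Hypotheses (eps_gt0 : 0 < eps) (Tvalid : valid_tests Rmax eps epst T).
Variables (Theta : 'M[R]_(nu p (nsteps p))).
Hypotheses (UTheta : Uset p Theta).
Hypothesis (xi_sub_gaussian : sub_gaussian (distribution P xi) 0 Theta).
Variables (t : nat) (k : 'I_(nshapes p)).
Hypotheses (t_ok : (1 <= t <= nsteps p)%N) (epst_gt0 : 0 < epst t).
Hypothesis (k_active : (rhot T t k < +oo)%E).

Let kappa := kappat Rmax eps epst t.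
Let kappa0 : 0 < kappa := kappat_gt0 Rmax eps_gt0 epst_gt0.

Lemma active_Kset : k \in Kset Rmax t kappa.
Proof.
case: (Tvalid k t_ok) => _; case: (k \in _) => // /(_ isT) rk.
by move: k_active; rewrite rk ltxx.
Qed.

Lemma active_saddle : exists r : R,
  [/\ rhot T t k = r%:E, 0 < r,
      is_saddle_point (Nobs p t) (Uobs t k r) (Ut p t)
        (ht T t k) (th1t T t k) (th2t T t k) (Thetat T t k) &
      sp_objective (ht T t k) (th1t T t k) (th2t T t k) (Thetat T t k) =
        ln kappa].
Proof.
have [+ _] := Tvalid k t_ok.
move=> /(_ active_Kset)[r [rk /andP[r0 _] SVr sp]]; exists r; split=> //.
by move: SVr; rewrite /SV (sp_value_saddle sp) => -[].
Qed.

Let Ut_Theta : Ut p t (Smx p t *m Theta *m (Smx p t)^T).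
Proof. by exists Theta. Qed.

Lemma false_alarm_le x : Nset p x ->
  (P [set w | (detector T k (obs x (xi w) t) < alphat Rmax eps epst t)%R] <=
    (kappa ^+ 2 / eps)%:E)%E.
Proof.
move=> Nx; have [r [_ r0 sp obj]] := active_saddle.
have Nobsx : Nobs p t (Abar p t *m x) by exists x.
have := saddle_le1 sp Nobsx Ut_Theta.
rewrite obj quadf_congr => le_obj.
set h := ht T t k in le_obj; set g := (Smx p t)^T *m h in le_obj.
set c := 2^-1 * dotv h (th1t T t k + th2t T t k) in le_obj.
(* An alarm is a lower tail of [g], hence an upper tail of [- g] at level [a]. By [le_obj] the
   exponent is at most [ln kappa + alphat], that is, the logarithm of [kappa ^+ 2 / eps]. *)
pose a := dotv h (Abar p t *m x) - c - alphat Rmax eps epst t.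
apply: (@le_trans _ _ (P [set w | (a <= dotv (- g) (xi w))%R])).
  apply: le_measure; rewrite ?inE.
  - exact: measurable_alarm.
  - rewrite -[mkset _]setTI; apply: measurable_fun_ler => //.
    exact: measurable_dotv_comp.
  - move=> w /=; rewrite detector_obs -/h -/g -/c dotvNl /a; lra.
apply: le_trans (sub_gaussian_tail (- g) a xi_sub_gaussian) _.
have -> : kappa ^+ 2 / eps = expR (ln kappa + alphat Rmax eps epst t).
  by rewrite expRD /alphat !lnK ?posrE ?divr_gt0// expr2 mulrA.
rewrite lee_fin ler_expR quadfN /a; lra.
Qed.

Lemma missed_detection_le (hp : standing_assumptions p) rho x :
  (rhot T t k <= rho%:E)%E -> signals k rho x ->
  (P [set w | (alphat Rmax eps epst t <= detector T k (obs x (xi w) t))%R] <=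
    eps%:E)%E.
Proof.
have [r [-> r0 sp obj]] := active_saddle.
rewrite lee_fin => rrho /(signals_nincr hp r0 rrho) sx.
have Uobsx : Uobs t k r (Abar p t *m x) by exists x.
have := saddle_le2 sp Uobsx Ut_Theta.
rewrite obj quadf_congr => le_obj.
set h := ht T t k in le_obj; set g := (Smx p t)^T *m h in le_obj.
set c := 2^-1 * dotv h (th1t T t k + th2t T t k) in le_obj.
(* A miss is an upper tail of [g] at level [a], with exponent at most
   [ln kappa - alphat = ln eps]. *)
pose a := alphat Rmax eps epst t + c - dotv h (Abar p t *m x).
rewrite (_ : mkset _ = [set w | a <= dotv g (xi w)]); last first.
  apply/seteqP; split=> w /=; rewrite detector_obs -/h -/g -/c /a; lra.
apply: le_trans (sub_gaussian_tail g a xi_sub_gaussian) _.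
have -> : eps = expR (ln kappa - alphat Rmax eps epst t).
  rewrite expRD expRN /alphat !lnK ?posrE ?divr_gt0// invf_div.
  by rewrite mulrC divfK// gt_eqF.
rewrite lee_fin ler_expR /a; lra.
Qed.

End detection.

(** * Assembling the detector bounds over shapes and times *)

Theorem proposition3p2 (R : realType) (p : problem R)
  (hp : standing_assumptions p)
  (Rmax : 'I_(nshapes p) -> R)
  (hRmax : forall k, is_max_magnitude k (Rmax k))
  (eps : R) (heps : 0 < eps < 2^-1)
  (epst : nat -> R)
  (hepst : forall t, (1 <= t <= nsteps p)%N -> 0 < epst t)
  (hsum : \sum_(1 <= t < (nsteps p).+1) epst t = eps)
  (T : tests p) (hT : valid_tests Rmax eps epst T)
  (disp : measure_display) (Omega : measurableType disp)
  (P : probability Omega R)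
  (xi : {mfun Omega >-> borel_cV R (nu p (nsteps p))})
  (Theta : 'M[R]_(nu p (nsteps p))) (hTheta : Uset p Theta)
  (hxi : sub_gaussian (distribution P xi) 0 Theta) :
  (forall x, Nset p x ->
     (forall t, (1 <= t <= nsteps p)%N ->
        (P [set w | signal_at Rmax eps epst T (obs x (xi w)) t]
           <= (epst t)%:E)%E) /\
     (P [set w | exists2 t, (1 <= t <= nsteps p)%N &
                   signal_at Rmax eps epst T (obs x (xi w)) t]
        <= eps%:E)%E) /\
  (forall (t : nat) (k : 'I_(nshapes p)), (1 <= t <= nsteps p)%N ->
     (rhot T t k < +oo)%E ->
     forall (rho : R) x, (rhot T t k <= rho%:E)%E -> signals k rho x ->
       ((1 - eps)%:E <=
          P [set w | exists2 s, (1 <= s <= t)%N &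
                       signal_at Rmax eps epst T (obs x (xi w)) s])%E).
Proof.
have eps0 : 0 < eps by case/andP: heps.
split=> [x Nx|t k t_ok k_active rho x le_rho sx].
  have signal_le t : (1 <= t <= nsteps p)%N ->
      (P [set w | signal_at Rmax eps epst T (obs x (xi w)) t] <=
        (epst t)%:E)%E.
    move=> t_ok; have et0 := hepst t t_ok.
    set kappa := kappat Rmax eps epst t.
    have kappa0 : 0 < kappa := kappat_gt0 Rmax eps0 et0.
    (* Stopping at [t] entails a claim at [t], which is a union over the active shapes. *)
    apply: (@le_trans _ _
        (P [set w | claims Rmax eps epst T (obs x (xi w) t)])).
      apply: le_measure; rewrite ?inE; last by move=> w [].
        exact: measurable_signal_at.
      exact: measurable_claims.
    rewrite claimsE.
    apply: le_trans (measure_exists2_seq_le (c := fun=> kappa ^+ 2 / eps) _ _) _.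
    - by move=> k _; exact: measurable_alarm.
    - move=> k; rewrite mem_enum inE => k_active.
      exact: (false_alarm_le eps0 hT hTheta hxi t_ok).
    rewrite lee_fin big_const_seq count_predT iter_addr_0 -cardE.
    (* Every active shape lies in [Kset] at [kappa], whose cardinality times [kappa ^+ 2] is at most
       [eps * epst t]. *)
    apply: (@le_trans _ _ (#|Kset Rmax t kappa|%:R * (kappa ^+ 2 / eps))).
      rewrite -[leLHS]mulr_natl ler_pM2r ?divr_gt0 ?exprn_gt0// ler_nat.
      apply/subset_leq_card/fintype.subsetP => k; rewrite inE => k_active.
      exact: (active_Kset hT t_ok k_active).
    have := card_Kset_kappat Rmax eps0 et0; rewrite -/kappa.
    rewrite ler_pdivlMr ?exprn_gt0// => card_le.
    by rewrite mulrA ler_pdivrMr// [leRHS]mulrC.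
  (* Rewriting with [-hsum] also expands the [eps] inside the events, hence the [hsum] in both side
     goals. *)
  split=> //; rewrite signal_beforeE -hsum.
  apply: measure_exists2_seq_le => t.
    by move=> _; rewrite hsum; exact: measurable_signal_at.
  by rewrite mem_index_iota ltnS hsum; exact: signal_le.
set E := mkset _.
have et0 := hepst t t_ok.
(* [M] is the miss of the single detector [k] at time [t]; outside it there is a claim at [t], hence
   a signal conclusion no later than [t]. *)
pose M := [set w | alphat Rmax eps epst t <= detector T k (obs x (xi w) t)].
have ME : ~` M `<=` E.
  move=> w /negP; rewrite -ltNge => lt_alpha.
  apply: claims_signal_before; first by case/andP: t_ok.
  by exists k.
have mM : measurable M.
  rewrite -[M]setCK; apply: measurableC.
  rewrite (_ : ~` M = [set w | detector T k (obs x (xi w) t) <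
                               alphat Rmax eps epst t]).
    exact: measurable_alarm.
  by apply/seteqP; split=> w /=; rewrite /M /= ltNge => /negP.
have PM : (P M <= eps%:E)%E :=
  missed_detection_le eps0 hT hTheta hxi t_ok et0 k_active hp le_rho sx.
apply: (@le_trans _ _ (P (~` M))); last first.
  by apply: le_measure => //; rewrite inE;
    [exact: measurableC|exact: measurable_signal_before].
by rewrite probability_setC// EFinB; exact: leeB.
Qed.
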